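(* Let $M$ be a finitely generated $A_n(K)$-module with a system of generators $f_1,\dots,f_m$, and for $r,s\in\mathbf Z$ let $M_{rs}=\sum_{i=1}^m W_{rs}f_i$. Then there exists a numerical polynomial $\phi_M(t_1,t_2)$ in two variables such that (i) $\phi_M(r,s)=\dim_KM_{rs}$ for all sufficiently large $(r,s)\in\mathbf Z^2$ (i.e. there exist $r_0,s_0$ such that this holds for all $r\ge r_0$, $s\ge s_0$); (ii) $\deg_{t_1}\phi_M\le n$ and $\deg_{t_2}\phi_M\le n$, so that $\deg\phi_M\le 2n$ and $\phi_M$ can be written as $$\phi_M(t_1,t_2)=\sum_{i=0}^n\sum_{j=0}^n a_{ij}\binom{t_1+i}{i}\binom{t_2+j}{j}$$ with $a_{ij}\in\mathbf Z$ for all $i,j$.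
   Context: $K$ is a field of characteristic zero and $A_n(K)$ is the Weyl algebra generated over $K$ by $x_1,\dots,x_n,\partial_1,\dots,\partial_n$, all pairs commuting except $\partial_ix_i=x_i\partial_i+1$; the monomials $x^\alpha\partial^\beta$ ($\alpha,\beta\in\mathbf N^n$) form a $K$-basis. For $r,s\in\mathbf N$, $W_{rs}$ is the $K$-span of the monomials $x^\alpha\partial^\beta$ with $|\alpha|\le r$ and $|\beta|\le s$; $W_{rs}=0$ if $r<0$ or $s<0$. A polynomial $f(t_1,t_2)\in\mathbf Q[t_1,t_2]$ is numerical if $f(r,s)\in\mathbf Z$ for all sufficiently large integers $r,s$. $\binom{t}{k}=t(t-1)\cdots(t-k+1)/k!$, $\binom t0=1$. *)

(* Defs.v *)
From HB Require Import structures.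
From mathcomp Require Import all_boot all_order all_algebra.
Set Implicit Arguments. Unset Strict Implicit. Unset Printing Implicit Defensive.
Import Order.TTheory GRing.Theory Num.Theory.
Local Open Scope ring_scope.

(* An A_n(K)-module is encoded as a K-vector space M together with the
   actions of the generators x_i (X i) and d_i (D i), which are K-linear
   and satisfy the defining relations of the Weyl algebra:
   all pairs commute except  d_i x_i = x_i d_i + 1. *)
Definition weyl_action (K : fieldType) (M : lmodType K) (n : nat)
  (X D : 'I_n -> M -> M) : Prop :=
  [/\ (forall i (a : K) (u v : M), X i (a *: u + v) = a *: X i u + X i v),
      (forall i (a : K) (u v : M), D i (a *: u + v) = a *: D i u + D i v),
      (forall i j (v : M), X i (X j v) = X j (X i v)),
      (forall i j (v : M), D i (D j v) = D j (D i v)) &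
      (forall i j (v : M), D i (X j v) = X j (D i v) + (if i == j then v else 0))].

Definition generates (K : fieldType) (M : lmodType K) (n m : nat)
  (X D : 'I_n -> M -> M) (f : 'I_m -> M) : Prop :=
  forall P : M -> Prop,
    P 0 -> (forall (a : K) u v, P u -> P v -> P (a *: u + v)) ->
    (forall i v, P v -> P (X i v)) -> (forall i v, P v -> P (D i v)) ->
    (forall k, P (f k)) -> forall v, P v.

Definition weyl_mono (K : fieldType) (M : lmodType K) (n : nat)
  (X D : 'I_n -> M -> M) (alpha beta : 'I_n -> nat) (v : M) : M :=
  foldr (fun i w => iter (alpha i) (X i) w)
    (foldr (fun i w => iter (beta i) (D i) w) v (enum 'I_n)) (enum 'I_n).

(* v belongs to M_{rs} = sum_k W_{rs} f_k : a K-linear combination of the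
   x^alpha d^beta f_k with |alpha| <= r, |beta| <= s.  (Exponents are at most
   r resp. s, so they range over a finite type.) *)
Definition in_Mrs (K : fieldType) (M : lmodType K) (n m : nat)
  (X D : 'I_n -> M -> M) (f : 'I_m -> M) (r s : nat) (v : M) : Prop :=
  exists c : {ffun 'I_m * {ffun 'I_n -> 'I_r.+1} * {ffun 'I_n -> 'I_s.+1} -> K},
    v = \sum_(t : 'I_m * {ffun 'I_n -> 'I_r.+1} * {ffun 'I_n -> 'I_s.+1} |
               ((\sum_i (val (t.1.2 i)) <= r)%N && (\sum_i (val (t.2 i)) <= s)%N))
          c t *: weyl_mono X D (fun i => val (t.1.2 i)) (fun i => val (t.2 i)) (f t.1.1).

Definition lin_free (K : fieldType) (M : lmodType K) (d : nat) (v : 'I_d -> M) : Prop :=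
  forall c : 'I_d -> K, \sum_k c k *: v k = 0 -> forall k, c k = 0.

Definition has_dim (K : fieldType) (M : lmodType K) (P : M -> Prop) (d : nat) : Prop :=
  (exists v : 'I_d -> M, (forall k, P (v k)) /\ lin_free v) /\
  (forall v : 'I_d.+1 -> M, (forall k, P (v k)) -> ~ lin_free v).

(* Main.v *)
(** Order the monomials x^alpha d^beta f_k lexicographically and call one reducible in
M_rs if it lies in the span of the smaller ones in M_rs; the irreducible monomials form
a basis of M_rs. Pad alpha and beta with the slack coordinates r - |alpha| and s -
|beta|, so that for each k the irreducible monomials, over all (r,s) together, become a
subset S of N^(n+1) x N^(n+1), bigraded by (r,s). Multiplying a relation by x_i or d_i,
or regarding it in M_(r+1,s) or M_(r,s+1), shows that S is closed under decreasing a
coordinate: the commutator term of d_i x^alpha is lexicographically smaller, so it does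
not disturb the leading monomial. By Dickson's lemma and induction on the number of
coordinates, the bigraded generating function of such a set is a polynomial divided by
(1-u)^(n+1) (1-v)^(n+1), whose coefficients are eventually of the required form. *)
Require Import Defs.
From HB Require Import structures.
From mathcomp Require Import all_boot all_order all_algebra.
From mathcomp Require Import boolp.
From mathcomp Require Import ring zify.
Set Implicit Arguments. Unset Strict Implicit. Unset Printing Implicit Defensive.
Import Order.TTheory GRing.Theory Num.Theory.
Local Open Scope ring_scope.

(** * Hilbert functions of down-closed sets *)

(** The coefficient of u^r in u^t / (1-u)^p: each division by 1-u is a partial summation. *)
Fixpoint ssum (p t r : nat) : int :=
  if p is p'.+1 then \sum_(u < r.+1) ssum p' t u else (t == r)%:Z.

Lemma ssumS0 (p t : nat) : ssum p t.+1 0 = 0.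
Proof. by elim: p => [|p IHp] //=; rewrite big_ord1. Qed.

Lemma ssumSS (p t r : nat) : ssum p t.+1 r.+1 = ssum p t r.
Proof.
elim: p r => [|p IHp] r /=; first by rewrite eqSS.
by rewrite big_ord_recl ssumS0 add0r; apply: eq_bigr => u _; rewrite IHp.
Qed.

Lemma ssum_diff (p t r : nat) : ssum p t r = ssum p.+1 t r - ssum p.+1 t.+1 r.
Proof.
case: r => [|r]; first by rewrite ssumS0 subr0 /= big_ord1.
by rewrite ssumSS /= [in RHS]big_ord_recr /= addrAC subrr add0r.
Qed.

Lemma ssum_bin (n r : nat) : ssum n.+1 0 r = 'C(r + n, n)%:Z.
Proof.
elim: n r => [|n IHn] r.
  by rewrite /= big_ord_recl big1 ?addr0 ?bin0.
suff H u : \sum_(i < u.+1) ssum n.+1 0 i = 'C(u + n.+1, n.+1)%:Z by exact: H.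
elim: u => [|u IHu]; first by rewrite big_ord1 IHn !add0n !binn.
by rewrite big_ord_recr IHu IHn addnS addSn binS addnS PoszD.
Qed.

(** Induction on t through u^(t+1)/(1-u)^(n+1) = u^t/(1-u)^(n+1) - u^t/(1-u)^n. At n = 0 the
    subtracted term is the monomial u^t, which does not contribute once r > t. *)
Lemma ssum_poly (n t : nat) : exists a : nat -> int, forall r, (t <= r)%N ->
  ssum n.+1 t r = \sum_(i < n.+1) a i * 'C(r + i, i)%:Z.
Proof.
elim: t n => [|t IHt] n.
  exists (fun i => (i == n)%:Z) => r _; rewrite ssum_bin big_ord_recr /= eqxx mul1r.
  by rewrite big1 ?add0r // => i _; rewrite ltn_eqF ?mul0r.
have [a aP] := IHt n; case: n a aP => [|n] a aP.
  exists a => r tr; rewrite -aP ?(ltnW tr) //.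
  by apply/esym/eqP; rewrite -subr_eq0 -ssum_diff /= ltn_eqF.
have [b bP] := IHt n.
(* The expansion given by [b] has one term fewer, so the top coefficient is that of [a]. *)
exists (fun i => a i - (if (i < n.+1)%N then b i else 0)) => r tr.
have -> : ssum n.+2 t.+1 r = ssum n.+2 t r - ssum n.+1 t r.
  by rewrite [ssum n.+1 t r]ssum_diff opprB addrC subrK.
rewrite aP ?bP ?(ltnW tr) // [in LHS]big_ord_recr [in RHS]big_ord_recr /= ltnn subr0.
rewrite addrAC -sumrB; congr (_ + _); apply: eq_bigr => i _.
by rewrite ltn_ord mulrBl.
Qed.

(* The generating function of [h] is a polynomial divided by (1-u)^p (1-v)^q. *)
Definition hilb2 (p q : nat) (h : nat -> nat -> int) : Prop :=
  exists l : seq (int * (nat * nat)), forall r s,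
    h r s = \sum_(x <- l) x.1 * (ssum p x.2.1 r * ssum q x.2.2 s).

Lemma eq_hilb2 p q h1 h2 :
  (forall r s, h1 r s = h2 r s) -> hilb2 p q h1 -> hilb2 p q h2.
Proof. by move=> eh [l lP]; exists l => r s; rewrite -eh lP. Qed.

Lemma hilb2_swap p q h : hilb2 p q h -> hilb2 q p (fun r s => h s r).
Proof.
case=> l lP; exists [seq (x.1, (x.2.2, x.2.1)) | x <- l] => r s.
by rewrite lP big_map; apply: eq_bigr => x _ /=; rewrite [ssum p _ _ * _]mulrC.
Qed.

Lemma hilb2_0 p q : hilb2 p q (fun _ _ => 0).
Proof. by exists [::] => r s; rewrite big_nil. Qed.

Lemma hilb2D p q h1 h2 :
  hilb2 p q h1 -> hilb2 p q h2 -> hilb2 p q (fun r s => h1 r s + h2 r s).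
Proof. by move=> [l1 P1] [l2 P2]; exists (l1 ++ l2) => r s; rewrite big_cat /= P1 P2. Qed.

Lemma hilb2_sum p q (I : Type) (l : seq I) (h : I -> nat -> nat -> int) :
  (forall i, hilb2 p q (h i)) -> hilb2 p q (fun r s => \sum_(i <- l) h i r s).
Proof.
move=> hP; elim: l => [|i l IHl].
  by apply: eq_hilb2 (hilb2_0 p q) => r s; rewrite big_nil.
by apply: eq_hilb2 (hilb2D (hP i) IHl) => r s; rewrite big_cons.
Qed.

(** Numerator and denominator are both multiplied by 1-u. *)
Lemma hilb2_widen p q h : hilb2 p q h -> hilb2 p.+1 q h.
Proof.
case=> l lP.
exists (l ++ [seq (- x.1, (x.2.1.+1, x.2.2)) | x <- l]) => r s.
rewrite big_cat /= big_map lP -big_split /=; apply: eq_bigr => x _ /=.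
by rewrite ssum_diff /=; ring.
Qed.

Lemma hilb2_shift p q h :
  hilb2 p q h -> hilb2 p q (fun r s => if r is r'.+1 then h r' s else 0).
Proof.
case=> l lP; exists [seq (x.1, (x.2.1.+1, x.2.2)) | x <- l] => r s.
rewrite big_map; case: r => [|r].
  by rewrite big1 // => x _; rewrite ssumS0 mul0r mulr0.
by rewrite lP; apply: eq_bigr => x _; rewrite ssumSS.
Qed.

Lemma hilb2_psum p q h :
  hilb2 p q h -> hilb2 p.+1 q (fun r s => \sum_(u < r.+1) h u s).
Proof.
case=> l lP; exists l => r s.
under eq_bigr do rewrite lP.
rewrite exchange_big; apply: eq_bigr => x _ /=.
by rewrite mulr_suml mulr_sumr.
Qed.

(** The series is the sum of the u^t G_t. The slices agree from t0 on, so the tail is u^t0 G_t0 /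
    (1-u), and the finitely many earlier terms can be widened to the same denominator. The induction
    peels off slice 0 and shifts the rest. *)
Lemma hilb2_slices p q (g : nat -> nat -> nat -> int) (t0 : nat) :
    (forall t, hilb2 p q (g t)) ->
    (forall t, (t0 <= t)%N -> forall r s, g t r s = g t0 r s) ->
  hilb2 p.+1 q (fun r s => \sum_(t < r.+1) g t (r - t)%N s).
Proof.
elim: t0 g => [|t0 IHt] g gP gE.
  apply: eq_hilb2 (hilb2_psum (gP 0)) => r s.
  (* All slices agree here, and reversing the sum turns it into a partial sum of [g 0]. *)
  rewrite (reindex_inj rev_ord_inj) /=; apply: eq_bigr => t _.
  by rewrite subSS [RHS]gE.
have /hilb2_shift H : hilb2 p.+1 q (fun r s => \sum_(t < r.+1) g t.+1 (r - t)%N s).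
  by apply: (IHt (fun t => g t.+1)) => // t tt r s; rewrite [LHS]gE // [RHS]gE.
apply: eq_hilb2 (hilb2D (hilb2_widen (gP 0)) H) => r s.
rewrite big_ord_recl subn0; congr (_ + _); case: r => [|r]; first by rewrite big_ord0.
by apply: eq_bigr => t _; rewrite subSS.
Qed.

(** Each numerator term contributes a product of two one-variable polynomials once r and s reach its
    exponents; [r0] and [s0] bound these exponents. *)
Lemma hilb2_poly (n : nat) h : hilb2 n.+1 n.+1 h ->
  exists a : 'I_n.+1 -> 'I_n.+1 -> int, exists r0 s0 : nat, forall r s : nat,
    (r0 <= r)%N -> (s0 <= s)%N ->
    h r s = \sum_(i < n.+1) \sum_(j < n.+1)
                a i j * ('C(r + i, i) * 'C(s + j, j))%:Z.
Proof.
case=> l hP.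
suff [a [r0 [s0 aP]]] : exists a : 'I_n.+1 -> 'I_n.+1 -> int, exists r0 s0 : nat, forall r s,
    (r0 <= r)%N -> (s0 <= s)%N ->
    \sum_(x <- l) x.1 * (ssum n.+1 x.2.1 r * ssum n.+1 x.2.2 s) =
    \sum_(i < n.+1) \sum_(j < n.+1) a i j * ('C(r + i, i) * 'C(s + j, j))%:Z.
  by exists a, r0, s0 => r s rr ss; rewrite hP aP.
elim: l {h hP} => [|[c [t u]] l [a [r0 [s0 aP]]]].
  exists (fun _ _ => 0), 0, 0 => r s _ _.
  by rewrite big_nil big1 // => i _; rewrite big1 // => j _; rewrite mul0r.
have [b1 b1P] := ssum_poly n t; have [b2 b2P] := ssum_poly n u.
exists (fun i j : 'I_n.+1 => c * (b1 i * b2 j) + a i j).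
exists (maxn t r0), (maxn u s0) => r s; rewrite !geq_max => /andP[tr rr] /andP[us ss].
rewrite big_cons aP // b1P // b2P // big_distrlr mulr_sumr -big_split.
apply: eq_bigr => i _; rewrite /= mulr_sumr -big_split; apply: eq_bigr => j _ /=.
by rewrite PoszM; ring.
Qed.

(** * Down-closed sets and Dickson's lemma *)

Definition down_closed (d : nat) (S : seq nat -> bool) : Prop :=
  forall v i, size v = d -> (i < d)%N -> S (incr_nth v i) -> S v.

Lemma down_closed_slice (d : nat) (S : seq nat -> bool) (t : nat) :
  down_closed d.+1 S -> down_closed d (fun v => S (t :: v)).
Proof. by move=> SP v i sv id; apply: (SP (t :: v) i.+1) => //=; rewrite sv. Qed.

Lemma homo_chain (R : nat -> bool) :
  (forall t, R t.+1 -> R t) -> forall t u, (t <= u)%N -> R u -> R t.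
Proof. by move=> RP t u /subnKC <-; elim: (u - t)%N => [|k IH]; rewrite ?addn0 // addnS => /RP. Qed.

(* Dickson's lemma, as the descending chain condition on down-closed subsets of N^d; the
   diagonal slices control all slices of large index. *)
Lemma down_closed_chain (d : nat) (S : nat -> seq nat -> bool) :
    (forall t, down_closed d (S t)) ->
    (forall t v, size v = d -> S t.+1 v -> S t v) ->
  exists t0, forall t, (t0 <= t)%N -> forall v, size v = d -> S t v = S t0 v.
Proof.
elim: d S => [|d IHd] S SP Sdec.
  (* In dimension 0 the chain is a decreasing sequence of truth values: constantly true, or false
     from some t on. *)
  have [[t nSt]|H] := pselect (exists t, ~~ S t [::]); last first.
    have {}H t : S t [::] by apply: contrapT => /negP nS; apply: H; exists t.
    by exists 0 => t _ v /size0nil ->; rewrite !H.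
  exists t => u tu v /size0nil ->; rewrite (negbTE nSt); apply: contraNF nSt.
  by apply: (homo_chain (R := fun t => S t [::])) tu => k; apply: Sdec.
have dect t u k v : size v = d -> (t <= u)%N -> S u (k :: v) -> S t (k :: v).
  move=> sv; apply: (homo_chain (R := fun t => S t (k :: v))) => i.
  by apply: Sdec; rewrite /= sv.
have deck t k l v : size v = d -> (k <= l)%N -> S t (l :: v) -> S t (k :: v).
  move=> sv; apply: (homo_chain (R := fun k => S t (k :: v))) => i.
  by apply: (SP t (i :: v) 0) => //=; rewrite sv.
have [t0 t0P] : exists t0, forall t, (t0 <= t)%N -> forall v, size v = d ->
    S t (t :: v) = S t0 (t0 :: v).
  apply: (IHd (fun t v => S t (t :: v))) => [t|t v sv]; first exact: down_closed_slice.
  by move=> /(dect t _ _ _ sv (leqnSn t)); apply: deck.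
(* The finitely many slices of index below [t0] stabilise separately; a common bound is the
   maximum. *)
have [t1 t1P] : exists t1, forall k, (k < t0)%N -> forall t, (t1 <= t)%N ->
    forall v, size v = d -> S t (k :: v) = S t1 (k :: v).
  elim: t0 {t0P} => [|k [t1 t1P]]; first by exists 0.
  have [t2 t2P] := IHd (fun t v => S t (k :: v)) (fun t => @down_closed_slice d (S t) k (SP t))
    (fun t v sv => dect t t.+1 k v sv (leqnSn t)).
  exists (maxn t1 t2) => j; rewrite ltnS leq_eqVlt => /predU1P[->|jk] t;
    rewrite geq_max => /andP[t1t t2t] v sv.
    by rewrite [LHS]t2P // [RHS]t2P // leq_maxr.
  by rewrite [LHS]t1P // [RHS]t1P // leq_maxl.
exists (maxn t0 t1) => t; rewrite geq_max => /andP[t0t t1t] [//|k v] [sv].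
have [kt0|t0k] := ltnP k t0.
  by rewrite [LHS]t1P // [RHS]t1P // leq_maxr.
(* For u and k at least [t0], the slice k of [S u] lies between the diagonal slices of index max(u,
   k) and [t0], which are equal. *)
have H u : (t0 <= u)%N -> S u (k :: v) = S t0 (t0 :: v).
  move=> t0u; apply/idP/idP => [/(dect t0 _ _ _ sv t0u)|]; first exact: deck.
  rewrite -(t0P (maxn u k) _ v sv) ?leq_max ?t0u // => Sm.
  by apply: (deck _ _ _ _ sv (leq_maxr u k)); apply: dect Sm => //; apply: leq_maxl.
by rewrite !H // leq_maxl.
Qed.

(** * Counting points by bidegree *)

Fixpoint comps (p r : nat) : seq (seq nat) :=
  if p is p'.+1 then [seq t :: v | t <- iota 0 r.+1, v <- comps p' (r - t)]
  else nseq (r == 0) [::].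

Lemma compsS (p r : nat) :
  comps p.+1 r = [seq t :: v | t <- iota 0 r.+1, v <- comps p (r - t)].
Proof. by []. Qed.

Lemma mem_comps (p r : nat) (v : seq nat) :
  (v \in comps p r) = (size v == p) && (sumn v == r).
Proof.
elim: p r v => [|p IHp] r v.
  by rewrite [comps _ _]/=; case: v r => [|x v] [].
apply/allpairsPdep/andP => [[t [u [+ + ->]]]|].
  rewrite mem_iota IHp /= ltnS => tr /andP[/eqP-> /eqP->].
  by rewrite subnKC.
case: v => [[]//|t v] [/eqP[sv] /eqP tv]; rewrite /= in tv.
by exists t, v; rewrite mem_iota IHp sv eqxx; split => //; lia.
Qed.

Lemma comps_uniq (p r : nat) : uniq (comps p r).
Proof.
elim: p r => [|p IHp] r; first by case: r.
apply: allpairs_uniq_dep; first exact: iota_uniq.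
  by move=> t _; apply: IHp.
by move=> [t u] [t' u'] _ _ /= [-> ->].
Qed.

Definition cnt (p q : nat) (S : seq nat -> bool) (r s : nat) : int :=
  \sum_(a <- comps p r) \sum_(b <- comps q s) (S (a ++ b))%:Z.

Lemma cntS (p q : nat) S r s :
  cnt p.+1 q S r s = \sum_(t < r.+1) cnt p q (fun v => S (nat_of_ord t :: v)) (r - t)%N s.
Proof.
by rewrite /cnt compsS big_allpairs_dep -[iota _ _]/(index_iota 0 r.+1) big_mkord.
Qed.

Lemma cnt0S (q : nat) S r s :
  cnt 0 q.+1 S r s = \sum_(t < s.+1) cnt 0 q (fun v => S (nat_of_ord t :: v)) r (s - t)%N.
Proof.
rewrite /cnt exchange_big compsS big_allpairs_dep -[iota _ _]/(index_iota 0 s.+1) big_mkord.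
apply: eq_bigr => t _.
by rewrite exchange_big; apply: eq_big_seq => a; rewrite mem_comps => /andP[/nilP-> _].
Qed.

Lemma eq_cnt (p q : nat) S1 S2 r s :
  (forall v, size v = p + q -> S1 v = S2 v)%N -> cnt p q S1 r s = cnt p q S2 r s.
Proof.
move=> eS; apply: eq_big_seq => a; rewrite mem_comps => /andP[/eqP sa _].
apply: eq_big_seq => b; rewrite mem_comps => /andP[/eqP sb _].
by rewrite eS // size_cat sa sb.
Qed.

(** Slicing along the first coordinate gives a decreasing chain of down-closed sets, which
    stabilises, so [hilb2_slices] applies. The first block is used up first; then the two variables
    are swapped to treat the second. *)
Lemma hilb2_cnt (p q : nat) S : down_closed (p + q) S -> hilb2 p q (cnt p q S).
Proof.
have chain d T : down_closed d.+1 T -> exists t0, forall t, (t0 <= t)%N ->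
    forall v, size v = d -> T (t :: v) = T (t0 :: v).
  move=> TP; apply: (down_closed_chain (S := fun t v => T (t :: v))) => [t|t v sv].
    exact: down_closed_slice.
  by apply: (TP (t :: v) 0) => //=; rewrite sv.
elim: p S => [|p IHp] S SP; last first.
  have [t0 t0P] := chain _ _ SP.
  apply: eq_hilb2 (fun r s => esym (cntS p q S r s)) _.
  apply: (@hilb2_slices p q (fun t => cnt p q (fun v => S (t :: v))) t0).
    by move=> t; apply/IHp/down_closed_slice.
  by move=> t tt r s; apply: eq_cnt; apply: t0P.
elim: q S SP => [|q IHq] S SP.
  exists [:: ((S [::])%:Z, (0, 0))] => r s; rewrite big_seq1 /cnt /=.
  by case: r s => [|r] [|s]; rewrite /= ?(big_seq1, big_nil, mulr0, mul0r, mulr1).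
have [t0 t0P] := chain _ _ SP.
apply: eq_hilb2 (fun r s => esym (cnt0S q S r s)) _.
apply: (@hilb2_swap q.+1 0 (fun s r => \sum_(t < s.+1) cnt 0 q (fun v => S (nat_of_ord t :: v)) r (s - t))).
apply: (@hilb2_slices q 0 (fun t s r => cnt 0 q (fun v => S (t :: v)) r s) t0).
  by move=> t; apply/hilb2_swap/IHq/down_closed_slice.
by move=> t tt r s; apply: eq_cnt; apply: t0P.
Qed.

(** * Greedy bases *)

Inductive lspan (K : fieldType) (M : lmodType K) (G : M -> Prop) : M -> Prop :=
| lspan0 : lspan G 0
| lspanZD a u v : G u -> lspan G v -> lspan G (a *: u + v).

Section Span.
Variables (K : fieldType) (M : lmodType K).
Implicit Types (G : M -> Prop) (u v : M) (l : seq M).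

Lemma lspan_gen G u : G u -> lspan G u.
Proof. by move=> Gu; rewrite -[u]scale1r -[_ *: u]addr0; apply: lspanZD => //; apply: lspan0. Qed.

Lemma lspanD G u v : lspan G u -> lspan G v -> lspan G (u + v).
Proof.
by elim=> [|a x y Gx _ IHy] Gv; rewrite ?add0r // -addrA; apply: lspanZD => //; apply: IHy.
Qed.

Lemma lspanZ G a u : lspan G u -> lspan G (a *: u).
Proof.
elim=> [|b x y Gx _ IHy]; first by rewrite scaler0; apply: lspan0.
by rewrite scalerDr scalerA; apply: lspanZD.
Qed.

Lemma lspan_sub G G' u : (forall v, G v -> lspan G' v) -> lspan G u -> lspan G' u.
Proof.
move=> GG'; elim=> [|a x y Gx _ IHy]; first exact: lspan0.
by apply: lspanD => //; apply/lspanZ/GG'.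
Qed.

Lemma eq_lspan G G' u : (forall v, G v <-> G' v) -> lspan G u <-> lspan G' u.
Proof. by move=> GG'; split; apply: lspan_sub => v /GG'; apply: lspan_gen. Qed.

Lemma lspan_map G G' (g : M -> M) u :
    (forall a x y, g (a *: x + y) = a *: g x + g y) ->
    (forall v, G v -> lspan G' (g v)) ->
  lspan G u -> lspan G' (g u).
Proof.
move=> gl gG; elim=> [|a x y Gx _ IHy].
  have /eqP := gl 1 0 0; rewrite !scale1r addr0 -subr_eq0 opprD addNKr oppr_eq0.
  by move/eqP->; apply: lspan0.
by rewrite gl; apply: lspanD => //; apply/lspanZ/gG.
Qed.

(** The greedy algorithm run from the end of the list: an element is kept, and counted, when it is
    independent of those behind it. *)
Fixpoint rk l : nat :=
  if l is u :: l' then (~~ `[< lspan (fun v => v \in l') u >] + rk l')%N else 0.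

Lemma rk_basis l : exists b : 'I_(rk l) -> M,
  [/\ lin_free b, forall k, lspan (fun v => v \in l) (b k)
    & forall u, lspan (fun v => v \in l) u -> exists c, u = \sum_k c k *: b k].
Proof.
have sub u x l' : lspan (fun v => v \in l') u -> lspan (fun v => v \in x :: l') u.
  by apply: lspan_sub => v vl; apply: lspan_gen; rewrite inE vl orbT.
elim: l => [|w l [b [bfree bspan bgen]]] /=.
  exists (fun _ => 0); split=> [c _ []//|[]//|u [|a x y]//].
  by exists (fun _ => 0); rewrite big_ord0.
case: asboolP => /= wl.
  exists b; split=> // [k|u ul]; first exact: sub.
  apply: bgen; apply: lspan_sub ul => v; rewrite inE => /predU1P[-> //|].
  exact: lspan_gen.
rewrite add1n; exists (fun k => if unlift ord0 k is Some j then b j else w); split.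
- move=> c; rewrite big_ord_recl unlift_none => c0.
  have bS : \sum_(i < rk l) c (lift ord0 i) *:
      (if unlift ord0 (lift ord0 i) is Some j then b j else w) =
      \sum_(i < rk l) c (lift ord0 i) *: b i by under eq_bigr do rewrite liftK.
  rewrite bS in c0.
  (* A nonzero coefficient of [w] would express [w] through the basis of the tail. *)
  have cw : c ord0 = 0.
    apply/eqP/negP => /negP cw; apply: wl.
    have -> : w = \sum_(i < rk l) (- (c ord0)^-1 * c (lift ord0 i)) *: b i.
      under eq_bigr do rewrite -scalerA; rewrite -scaler_sumr.
      move/eqP: c0; rewrite addrC addr_eq0 => /eqP->.
      by rewrite scalerN scaleNr opprK scalerA mulVf // scale1r.
    by elim/big_rec: _ => [|i u _ IHu]; [apply: lspan0|apply: lspanD => //; apply: lspanZ].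
  have cb := bfree (fun i => c (lift ord0 i)).
  move=> k; case: (unliftP ord0 k) => [j|] -> //.
  by apply: cb; rewrite cw scale0r add0r in c0.
- by move=> k; case: unlift => [j|]; [apply: sub|apply: lspan_gen; rewrite inE eqxx].
move=> u; elim=> [|a x y + _ [c ->]].
  by exists (fun _ => 0); rewrite big1 // => i _; rewrite scale0r.
rewrite inE => /predU1P[->|xl].
  exists (fun k => (if k == ord0 then a else 0) + c k).
  under [RHS]eq_bigr do rewrite scalerDl.
  rewrite big_split /=; congr (_ + _).
  by rewrite big_ord_recl unlift_none eqxx big1 ?addr0 // => i _; rewrite scale0r.
have [d ->] := bgen x (lspan_gen xl).
exists (fun k => a * (if unlift ord0 k is Some j then d j else 0) + c k).
under [RHS]eq_bigr do rewrite scalerDl -scalerA.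
rewrite big_split -scaler_sumr /=; congr (_ *: _ + _).
rewrite big_ord_recl unlift_none scale0r add0r.
by apply: eq_bigr => i _; rewrite liftK.
Qed.

(** The coordinates of d+1 vectors form a matrix with more rows than columns. Its left kernel is
    nonzero, and a nonzero row of it is a linear relation. *)
Lemma has_dim_basis (P : M -> Prop) (d : nat) (b : 'I_d -> M) :
    lin_free b -> (forall k, P (b k)) ->
    (forall u, P u -> exists c, u = \sum_k c k *: b k) ->
  has_dim P d.
Proof.
move=> bfree bP bgen; split; first by exists b.
move=> v /(_ _)/bgen vP vfree.
have [A AP] : exists A : 'M[K]_(d.+1, d), forall i, v i = \sum_k A i k *: b k.
  have [c cP] := fin_all_exists vP.
  exists (\matrix_(i, k) c i k) => i; rewrite cP.
  by apply: eq_bigr => k _; rewrite mxE.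
have /row_subP/(_ _)/sub_kermxP kA := submx_refl (kermx A).
have : kermx A != 0.
  by rewrite kermx_eq0 /row_free neq_ltn ltnS rank_leq_col.
case/matrix0Pn => i [j]; apply/negP; rewrite negbK; apply/eqP.
apply: (vfree (fun j => kermx A i j)).
under eq_bigr => l _ do rewrite AP scaler_sumr.
rewrite exchange_big big1 // => k _ /=.
under eq_bigr => l _ do rewrite scalerA.
rewrite -scaler_suml; suff -> : \sum_l kermx A i l * A l k = 0 by rewrite scale0r.
have /matrixP/(_ ord0 k) := kA i; rewrite [LHS]mxE [RHS]mxE => kAk.
by rewrite -[RHS]kAk; apply: eq_bigr => l _; rewrite [row _ _ _ _]mxE.
Qed.

Lemma eq_has_dim (P Q : M -> Prop) d :
  (forall u, P u <-> Q u) -> has_dim P d -> has_dim Q d.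
Proof.
move=> PQ [[v [vP vfree]] max]; split; first by exists v; split=> // k; apply/PQ.
by move=> u uQ; apply: max => k; apply/PQ.
Qed.

Lemma has_dim_lspan l : has_dim (lspan (fun v => v \in l)) (rk l).
Proof. by have [b [bfree bspan bgen]] := rk_basis l; apply: has_dim_basis bgen. Qed.

(** The order is on the indices, not on the vectors: of two indices in [L] with the same vector, the
    larger is reducible. *)
Definition irreducible disp (I : orderType disp) (L : seq I) (w : I -> M) (x : I) : bool :=
  ~~ `[< lspan (fun u => exists y, [/\ y \in L, (y < x)%O & u = w y]) (w x) >].

Lemma eq_irreducible disp (I : orderType disp) (L1 L2 : seq I) (w : I -> M) x :
    (forall y, (y < x)%O -> (y \in L1) = (y \in L2)) ->
  irreducible L1 w x = irreducible L2 w x.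
Proof.
move=> eL; congr (~~ _); apply: asbool_equiv_eq; apply: eq_lspan => u.
by split=> -[y [yL yx ->]]; exists y; rewrite ?eL // -eL.
Qed.

(** In decreasing order the entries behind x are exactly those of smaller index, so the greedy test
    is irreducibility. *)
Lemma rk_irreducible disp (I : orderType disp) (L : seq I) (w : I -> M) :
  uniq L -> rk (map w (rev (sort <=%O L))) = (\sum_(x <- L) irreducible L w x)%N.
Proof.
move=> uL; set L' := rev _.
have pL : perm_eq L L' by rewrite perm_sym /L' perm_rev perm_sort.
have : pairwise >%O L'.
  rewrite -sorted_pairwise; last by move=> y x z yx zy; apply: lt_trans zy yx.
  by rewrite /L' rev_sorted sort_lt_sorted.
rewrite (perm_big _ pL) /=; under eq_bigr do rewrite (eq_irreducible w (fun y _ => perm_mem pL y)).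
elim: L' {pL} => [|x l IHl] /=; first by rewrite big_nil.
case/andP=> /allP xl /IHl {IHl}->; rewrite big_cons; congr (_ + _)%N.
  congr (nat_of_bool (~~ _)); apply: asbool_equiv_eq; apply: eq_lspan => u; split.
    by case/mapP=> y yl ->; exists y; rewrite inE yl orbT; split=> //; apply: xl.
  case=> y [+ yx ->]; rewrite inE => /predU1P[yE|yl]; last exact: map_f.
  by rewrite yE ltxx in yx.
(* Removing the largest index x does not affect the test for smaller ones. *)
apply: eq_big_seq => y /xl yx; congr nat_of_bool; apply: eq_irreducible => z zy.
by rewrite inE; case: eqP => // zx; rewrite zx ltNge ltW in zy.
Qed.
End Span.

(** * Monomials of the Weyl algebra *)

(** The monomial order is compatible with multiplication by a generator and with raising a slack. *)
Lemma ltxi_incr_nth (u v : seq nat) (i : nat) : size u = size v -> (i < size u)%N ->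
  ((incr_nth u i : seqlexi nat) < incr_nth v i)%O = ((u : seqlexi nat) < v)%O.
Proof.
elim: u v i => [|x u IHu] [|y v] [|i] //= [suv] iu; rewrite !ltxi_cons ?leEnat //=.
by rewrite IHu.
Qed.

Lemma ltxi_nth (u v : seq nat) (i : nat) : size u = size v -> (i < size u)%N ->
  (forall j, (j < i)%N -> nth 0%N u j = nth 0%N v j) -> (nth 0%N u i < nth 0%N v i)%N ->
  ((u : seqlexi nat) < v)%O.
Proof.
elim: u v i => [|x u IHu] [|y v] [|i] //= [suv] iu uv uvi; rewrite ltxi_cons leEnat.
  by rewrite ltnW //= leqNgt uvi.
have /= -> := uv 0 isT; rewrite leqnn /=; apply: (IHu _ i) => // j ji.
exact: (uv j.+1).
Qed.

Lemma decr_nth (v : seq nat) (i : nat) : (0 < nth 0 v i)%N ->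
  exists2 u, size u = size v & v = incr_nth u i.
Proof.
elim: v i => [|x v IHv] [|i] //= vi.
  by exists (x.-1 :: v); rewrite /= ?prednK.
by have [u su vE] := IHv i vi; exists (x :: u); rewrite /= ?su -?vE.
Qed.

(** * Commutation rules for the generators *)

Section Action.
Variables (K : fieldType) (M : lmodType K) (n : nat).

(** One half of [weyl_mono], over an arbitrary list of indices so that induction is possible. *)
Definition act (Y : 'I_n -> M -> M) (e : 'I_n -> nat) (s : seq 'I_n) (v : M) : M :=
  foldr (fun i w => iter (e i) (Y i) w) v s.

Lemma eq_act Y e1 e2 s v : {in s, e1 =1 e2} -> act Y e1 s v = act Y e2 s v.
Proof.
elim: s => //= i s IHs e12; rewrite e12 ?mem_head // IHs // => j js.
by rewrite e12 // inE js orbT.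
Qed.

Section Commuting.
Variable Y : 'I_n -> M -> M.
Hypothesis Ylin : forall i (a : K) (u v : M), Y i (a *: u + v) = a *: Y i u + Y i v.
Hypothesis Ycomm : forall i j (v : M), Y i (Y j v) = Y j (Y i v).

Lemma iter_linear k i (a : K) (u v : M) :
  iter k (Y i) (a *: u + v) = a *: iter k (Y i) u + iter k (Y i) v.
Proof. by elim: k => //= k ->. Qed.

Lemma iter_comm k i j v : iter k (Y j) (Y i v) = Y i (iter k (Y j) v).
Proof. by elim: k => //= k ->. Qed.

Lemma act_incr (e : 'I_n -> nat) (s : seq 'I_n) (i : 'I_n) v : uniq s -> i \in s ->
  act Y (fun j => ((i == j) + e j)%N) s v = Y i (act Y e s v).
Proof.
elim: s => //= j s IHs /andP[js us]; rewrite inE => /predU1P[ij|is_].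
  rewrite -ij eqxx /= in js *; congr (Y i (iter _ _ _)); apply: eq_act => k ks.
  by rewrite (_ : (i == k) = false) //; apply: contraNF js => /eqP->.
rewrite IHs // (_ : (i == j) = false) ?add0n ?iter_comm //.
by apply: contraNF js => /eqP <-.
Qed.
End Commuting.

Variables X D : 'I_n -> M -> M.
Hypothesis hM : weyl_action X D.

(** The commutator is the derivative of x_j^k; at k = 0 the truncated predecessor is harmless, its
    coefficient being zero. *)
Lemma D_iter_X k i j v : D i (iter k (X j) v) =
  iter k (X j) (D i v) + (if i == j then k%:R *: iter k.-1 (X j) v else 0).
Proof.
have [Xlin _ _ _ DX] := hM; have Xadd a b : X j (a + b) = X j a + X j b.
  by have := Xlin j 1 a b; rewrite !scale1r.
have XZ a u : X j (a *: u) = a *: X j u.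
  have X0 : X j 0 = 0 by apply: (addrI (X j 0)); rewrite -Xadd !addr0.
  by have := Xlin j a u 0; rewrite X0 !addr0.
elim: k => [|k IHk] /=; first by rewrite scale0r if_same addr0.
rewrite DX IHk Xadd -addrA; congr (_ + _).
case: eqP => _; last first.
  by rewrite addr0; apply: (addrI (X j 0)); rewrite -Xadd !addr0.
rewrite XZ -natr1 scalerDl scale1r; congr (_ + _).
by case: k {IHk} => //=; rewrite !scale0r.
Qed.

Lemma D_act_X (e : 'I_n -> nat) (s : seq 'I_n) (i : 'I_n) v : uniq s -> i \in s ->
  D i (act X e s v) = act X e s (D i v) +
    (e i)%:R *: act X (fun j => (e j - (i == j))%N) s v.
Proof.
have [Xlin _ Xcomm _ _] := hM.
elim: s => //= j s IHs /andP[js us]; rewrite inE D_iter_X => ijs.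
have [ij|ij] := eqVneq i j; last first.
  have is_ : i \in s by case/predU1P: ijs ij => // ->; rewrite eqxx.
  rewrite addr0 IHs // addrC (iter_linear Xlin) addrC; congr (_ + _ *: iter _ _ _).
  by rewrite subn0.
(* The index i does not recur in the tail, so d_i commutes with all remaining factors. *)
have Dact : D i (act X e s v) = act X e s (D i v).
  rewrite -{}ij in js; elim: s {IHs us ijs} js => //= k s IHs.
  rewrite inE negb_or => /andP[ik /IHs sE].
  by rewrite D_iter_X sE (negbTE ik) addr0.
rewrite Dact ij subn1; congr (_ + _ *: iter _ _ _); apply: eq_act => k ks.
by rewrite (_ : (j == k) = false) ?subn0 //; apply: contraNF js => /eqP->.
Qed.
End Action.

(** * Padded exponent lists and their bidegrees *)

Definition bideg1 (n : nat) (v : seq nat) : nat := (\sum_(i < n.+1) nth 0 v i)%N.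
Definition bideg2 (n : nat) (v : seq nat) : nat := (\sum_(i < n.+1) nth 0 v (n.+1 + i))%N.

Lemma bideg1_incr n v j : bideg1 n (incr_nth v j) = (bideg1 n v + (j < n.+1))%N.
Proof.
rewrite /bideg1; under eq_bigr do rewrite nth_incr_nth.
rewrite big_split addnC /=; congr addn; case: ltnP => jn; last first.
  by rewrite big1 // => i _; rewrite gtn_eqF //; apply: leq_trans (ltn_ord i) jn.
rewrite (bigD1 (Ordinal jn)) //= eqxx big1 // => i.
by rewrite -val_eqE /= eq_sym => /negbTE->.
Qed.

Lemma bideg2_incr n v j : (j < n.+1 + n.+1)%N ->
  bideg2 n (incr_nth v j) = (bideg2 n v + (n.+1 <= j))%N.
Proof.
move=> jN; rewrite /bideg2; under eq_bigr do rewrite nth_incr_nth.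
rewrite big_split addnC /=; congr addn; case: (leqP n.+1 j) => jn; last first.
  by rewrite big1 // => i _; rewrite ltn_eqF //; apply: leq_trans jn (leq_addr _ _).
have jn' : (j - n.+1 < n.+1)%N by lia.
rewrite (bigD1 (Ordinal jn')) //= subnKC // eqxx big1 // => i.
by rewrite -val_eqE /= => ij; apply/eqP; rewrite eqb0; apply: contra ij; lia.
Qed.

(** With the slacks included, the bounds on |alpha| and |beta| become the exact bidegree (r,s). The
    index of the generator is compared first. *)
Definition midx (m n r s : nat) : seq (seqlexi nat) :=
  [seq k :: v | k <- iota 0 m, v <- [seq a ++ b | a <- comps n.+1 r, b <- comps n.+1 s]].

Lemma sumn_nth (v : seq nat) : sumn v = (\sum_(i < size v) nth 0 v i)%N.
Proof. by rewrite sumnE (big_nth 0%N) big_mkord. Qed.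

Lemma mem_midx (m n r s : nat) (x : seq nat) : x \in midx m n r s <->
  exists k v, [/\ x = k :: v, (k < m)%N, size v = (n.+1 + n.+1)%N,
                  bideg1 n v = r & bideg2 n v = s].
Proof.
split=> [/allpairsPdep[k [_ [+ /allpairsPdep[a [b [+ + ->]]] ->]]]|].
  rewrite mem_iota !mem_comps add0n => km /andP[/eqP sa /eqP ar] /andP[/eqP sb /eqP bs].
  exists k, (a ++ b); split; rewrite ?size_cat ?sa ?sb //.
    rewrite -ar sumn_nth sa; apply: eq_bigr => i _.
    by rewrite nth_cat sa ltn_ord.
  rewrite -bs sumn_nth sb; apply: eq_bigr => i _.
  by rewrite nth_cat sa ltnNge leq_addr /= addKn.
case=> k [v [-> km sv <- <-]]; apply/allpairsPdep; exists k, v; split=> //.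
  by rewrite mem_iota.
apply/allpairsPdep; exists (take n.+1 v), (drop n.+1 v); rewrite !mem_comps cat_take_drop.
have st : size (take n.+1 v) = n.+1 by rewrite size_takel // sv leq_addr.
have sd : size (drop n.+1 v) = n.+1 by rewrite size_drop sv addKn.
rewrite st sd !eqxx !sumn_nth st sd /=; split=> //; apply/eqP; apply: eq_bigr => i _.
  by rewrite nth_take.
by rewrite nth_drop.
Qed.

Lemma midx_uniq (m n r s : nat) : uniq (midx m n r s).
Proof.
apply: allpairs_uniq_dep; first exact: iota_uniq.
  move=> k _; apply: allpairs_uniq; try exact: comps_uniq.
  move=> u v /allpairsP[[a b] [aP _ ->]] /allpairsP[[a' b'] [aP' _ ->]].
  move: aP aP'; rewrite !mem_comps => /andP[/eqP/= sa _] /andP[/eqP/= sa' _] /eqP.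
  by rewrite eqseq_cat ?sa // => /andP[/eqP-> /eqP->].
by move=> [k v] [k' v'] _ _ /= [-> ->].
Qed.

(** * Leading monomials and their multiples *)

Section Monomials.
Variables (K : fieldType) (M : lmodType K) (n m : nat) (X D : 'I_n -> M -> M).
Hypothesis hM : weyl_action X D.
Variable f : nat -> M.

(* [k :: v] stands for x^alpha d^beta f_k, where [v] lists alpha, then r - |alpha|, then
   beta, then s - |beta|. *)
Definition mono (x : seq nat) : M :=
  weyl_mono X D (fun i => nth 0%N x i.+1) (fun i => nth 0%N x (n.+2 + i)%N) (f (head 0%N x)).

Definition below (r s : nat) (x : seqlexi nat) (u : M) : Prop :=
  exists y, [/\ y \in midx m n r s, (y < x)%O & u = mono y].

Lemma mono_X (i : 'I_n) x : mono (incr_nth x i.+1) = X i (mono x).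
Proof.
have [Xlin _ Xcomm _ _] := hM.
rewrite /mono /weyl_mono.
rewrite -[RHS](act_incr Xcomm) ?enum_uniq ?mem_enum //.
have -> : head 0%N (incr_nth x i.+1) = head 0%N x by case: x.
transitivity (act X (fun j : 'I_n => nth 0%N (incr_nth x i.+1) j.+1) (enum 'I_n)
  (act D (fun j : 'I_n => nth 0%N x (n.+2 + j)) (enum 'I_n) (f (head 0%N x)))).
  congr act; apply: eq_act => j _; rewrite nth_incr_nth ltn_eqF //.
  by rewrite addSn ltnS (leq_trans (ltn_ord i)) // ltnW // leq_addr.
by apply: eq_act => j _; rewrite nth_incr_nth eqSS.
Qed.

Lemma mono_D (i : 'I_n) x : D i (mono x) = mono (incr_nth x (n.+2 + i)) +
  (nth 0%N x i.+1)%:R *: weyl_mono X D (fun j => nth 0%N x j.+1 - (i == j))%N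
     (fun j => nth 0%N x (n.+2 + j)%N) (f (head 0%N x)).
Proof.
have [_ _ _ Dcomm _] := hM.
rewrite /mono /weyl_mono [LHS](D_act_X hM) ?enum_uniq ?mem_enum //; congr (_ + _).
have -> : head 0%N (incr_nth x (n.+2 + i)) = head 0%N x by case: x.
rewrite -(act_incr Dcomm) ?enum_uniq ?mem_enum //.
transitivity (act X (fun j : 'I_n => nth 0%N (incr_nth x (n.+2 + i)) j.+1) (enum 'I_n)
  (act D (fun j : 'I_n => (i == j) + nth 0%N x (n.+2 + j))%N (enum 'I_n) (f (head 0%N x)))).
  apply: eq_act => j _; rewrite nth_incr_nth gtn_eqF //.
  by rewrite addSn ltnS (leq_trans (ltn_ord j)) // ltnW // leq_addr.
by congr act; apply: eq_act => j _; rewrite nth_incr_nth eqn_add2l.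
Qed.

(** Raising a slack leaves the vector alone and only regards it in a larger M_rs. *)
Lemma mono_slack x j : j = n \/ j = (n.+1 + n)%N -> mono (incr_nth x j.+1) = mono x.
Proof.
move=> jE; rewrite /mono (_ : head 0%N (incr_nth x j.+1) = head 0%N x); last by case: x.
have E1 (i : 'I_n) : nth 0%N (incr_nth x j.+1) i.+1 = nth 0%N x i.+1.
  by rewrite nth_incr_nth (_ : _ == _ = false) //; have := ltn_ord i; case: jE; lia.
have E2 (i : 'I_n) : nth 0%N (incr_nth x j.+1) (n.+2 + i) = nth 0%N x (n.+2 + i).
  by rewrite nth_incr_nth (_ : _ == _ = false) //; have := ltn_ord i; case: jE; lia.
rewrite /weyl_mono -!/(act _ _ _ _) (eq_act X _ (e2 := fun i => nth 0%N x i.+1)); last by move=> i _.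
by congr (act _ _ _ _); apply: eq_act => i _.
Qed.

(** The error is a multiple of x^(alpha - e_i) d^beta f_k, smaller than the leading monomial because
    the exponent of x_i has dropped. *)
Lemma mono_err (i : 'I_n) k v : (k < m)%N -> size v = (n.+1 + n.+1)%N ->
  let v' := incr_nth v (n.+1 + i) in
  lspan (below (bideg1 n v') (bideg2 n v') (k :: v')) (mono (k :: v') - D i (mono (k :: v))).
Proof.
move=> km sv; have ni := ltn_ord i.
rewrite /= mono_D opprD addNKr -scaleNr.
have [->|vi] := posnP (nth 0%N (k :: v) i.+1).
  by rewrite oppr0 scale0r; apply: lspan0.
apply/lspanZ/lspan_gen; have [v0 sv0 vE] := @decr_nth v i vi.
rewrite vE /= in sv sv0 *; rewrite sv in sv0.
(* Both slacks go up by one: the first makes up for the lost x_i, the second for the d_i that was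
   not added. *)
pose y := incr_nth (incr_nth v0 n) (n.+1 + n).
have sy : size y = (n.+1 + n.+1)%N by rewrite !size_incr_nth sv0 !ifT //; lia.
exists (k :: y); split.
- apply/mem_midx; exists k, y; split=> //.
    by rewrite !bideg1_incr; lia.
  by rewrite !bideg2_incr; lia.
- rewrite ltxi_cons !lexx /=; apply: (ltxi_nth (i := i)).
  + by rewrite sy !size_incr_nth sv0 !ifT //; lia.
  + by rewrite sy; lia.
  + by move=> j ji; rewrite !nth_incr_nth; lia.
  + by rewrite !nth_incr_nth; lia.
transitivity (mono (k :: v0)); last first.
  rewrite -(mono_slack (j := n) (k :: v0)); last by left.
  by rewrite -(mono_slack (j := (n.+1 + n)%N) (incr_nth (k :: v0) n.+1)); last by right.
rewrite /mono /weyl_mono /=.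
transitivity (act X (fun j : 'I_n => nth 0%N v0 j) (enum 'I_n)
  (act D (fun j : 'I_n => nth 0%N (incr_nth v0 i) (n.+1 + j)) (enum 'I_n) (f k))).
  by apply: eq_act => j _; rewrite nth_incr_nth -val_eqE /= addKn.
congr (act _ _ _ _); apply: eq_act => j _; rewrite nth_incr_nth; lia.
Qed.

(** The operator is x_j or d_i on an exponent coordinate and the identity on a slack; only d_i
    leaves an error. *)
Lemma mono_incr (j : nat) : (j < n.+1 + n.+1)%N -> exists2 g : M -> M,
    (forall (a : K) u v, g (a *: u + v) = a *: g u + g v) &
    forall k v, (k < m)%N -> size v = (n.+1 + n.+1)%N ->
      let v' := incr_nth v j in
      lspan (below (bideg1 n v') (bideg2 n v') (k :: v')) (mono (k :: v') - g (mono (k :: v))).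
Proof.
have [Xlin Dlin _ _ _] := hM.
move=> jN; have [jn|nj] := ltnP j n.
  exists (X (Ordinal jn)) => // k v _ _.
  by rewrite /= -(mono_X (Ordinal jn) (k :: v)) /= subrr; apply: lspan0.
have [jn|jn] : (exists i : 'I_n, j = n.+1 + i)%N \/ (j = n \/ j = n.+1 + n)%N.
  case: (ltnP n j) => nj'; last by right; lia.
  case: (ltnP (j - n.+1) n) => jn; last by right; lia.
  by left; exists (Ordinal jn) => /=; lia.
  by case: jn => i ->; exists (D i) => // k v; apply: mono_err.
exists id => // k v _ _ /=.
by rewrite -[k :: incr_nth v j]/(incr_nth (k :: v) j.+1) mono_slack // subrr; apply: lspan0.
Qed.

(** Reducibility passes to multiples: the operator of [mono_incr] is applied to the relation, and
    each smaller monomial goes to its own multiple, still smaller, up to even smaller terms. The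
    contrapositive is down-closure of the irreducible set. *)
Lemma lspan_below_incr (k j : nat) (v : seq nat) :
    (k < m)%N -> size v = (n.+1 + n.+1)%N -> (j < n.+1 + n.+1)%N ->
    let v' := incr_nth v j in
  lspan (below (bideg1 n v) (bideg2 n v) (k :: v)) (mono (k :: v)) ->
  lspan (below (bideg1 n v') (bideg2 n v') (k :: v')) (mono (k :: v')).
Proof.
move=> km sv jN v'; have [g glin gP] := mono_incr jN.
move=> vP; rewrite -[mono _](subrK (g (mono (k :: v)))).
apply: lspanD; first exact: gP.
apply: lspan_map vP => // u [y [/mem_midx[l [z [-> lm sz z1 z2]]] zv ->]].
have lt' : ((l :: incr_nth z j : seqlexi nat) < k :: v')%O.
  have := @ltxi_incr_nth (l :: z) (k :: v) j.+1; rewrite /= => -> //; first by rewrite sz sv.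
  by rewrite sz.
have z1' : bideg1 n (incr_nth z j) = bideg1 n v' by rewrite !bideg1_incr z1.
have z2' : bideg2 n (incr_nth z j) = bideg2 n v' by rewrite !bideg2_incr // z2.
rewrite -[g _](subKr (mono (l :: incr_nth z j))); apply: lspanD.
  apply: lspan_gen; exists (l :: incr_nth z j); split=> //; apply/mem_midx.
  by exists l, (incr_nth z j); split=> //; rewrite size_incr_nth sz jN.
rewrite -scaleN1r; apply: lspanZ; have /= := gP l z lm sz; rewrite z1' z2'.
apply: lspan_sub => w [y' [ym yl ->]]; apply: lspan_gen; exists y'; split=> //.
exact: lt_trans yl lt'.
Qed.
End Monomials.

(** * Dimensions of the M_rs *)

Lemma in_MrsE (K : fieldType) (M : lmodType K) (n m : nat) (X D : 'I_n -> M -> M)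
  (f : 'I_m -> M) (r s : nat) (u : M) :
  in_Mrs X D f r s u <->
  lspan (fun w => exists2 x, x \in midx m n r s
                 & w = mono X D (fun k => oapp f 0 (insub k)) x) u.
Proof.
split=> [[c ->]|].
  elim/big_rec: _ => [|t v /andP[tr ts] vP]; first exact: lspan0.
  apply: lspanD => //; apply/lspanZ/lspan_gen.
  case: t tr ts => [[k al] be] /= alr bes.
  pose a := [seq val (al i) | i <- enum 'I_n]; pose b := [seq val (be i) | i <- enum 'I_n].
  have sa : size a = n by rewrite size_map size_enum_ord.
  have sb : size b = n by rewrite size_map size_enum_ord.
  have na (i : 'I_n) : nth 0%N a i = al i.
    by rewrite (nth_map i) ?size_enum_ord // nth_ord_enum.
  have nb (i : 'I_n) : nth 0%N b i = be i.
    by rewrite (nth_map i) ?size_enum_ord // nth_ord_enum.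
  (* The slacks r - |alpha| and s - |beta| fill the last place of each half. *)
  pose v' := rcons a (r - \sum_i val (al i))%N ++ rcons b (s - \sum_i val (be i))%N.
  have n1 (i : 'I_n) : nth 0%N v' i = al i.
    by rewrite nth_cat size_rcons sa ltnS ltnW // nth_rcons sa ltn_ord na.
  have n2 (i : 'I_n) : nth 0%N v' (n.+1 + i) = be i.
    by rewrite nth_cat size_rcons sa ltnNge leq_addr addKn /= nth_rcons sb ltn_ord nb.
  exists (val k :: v'); last first.
    rewrite /mono /weyl_mono /= valK /=.
    transitivity (act X (fun j : 'I_n => nth 0%N v' j) (enum 'I_n)
      (act D (fun j : 'I_n => val (be j)) (enum 'I_n) (f k))).
      by apply: eq_act => j _; rewrite n1.
    by congr (act _ _ _ _); apply: eq_act => j _; rewrite n2.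
  apply/mem_midx; exists (val k), v'; split=> //.
  - exact: ltn_ord.
  - by rewrite size_cat !size_rcons sa sb.
  - rewrite /bideg1 big_ord_recr /= (eq_bigr (fun i => val (al i))) => [|i _]; last exact: n1.
    by rewrite nth_cat size_rcons sa ltnSn nth_rcons sa ltnn eqxx subnKC.
  rewrite /bideg2 big_ord_recr /= (eq_bigr (fun i => val (be i))) => [|i _]; last exact: n2.
  by rewrite nth_cat size_rcons sa ltnNge leq_addr addKn /= nth_rcons sb ltnn eqxx subnKC.
elim=> [|a w v [_ /mem_midx[k [x [-> km sx x1 x2]]] ->] _ [c ->]].
  by exists [ffun=> 0]; rewrite big1 // => t _; rewrite ffunE scale0r.
have le1 : (\sum_(i < n) nth 0%N x i <= r)%N.
  by rewrite -x1 /bideg1 big_ord_recr leq_addr.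
have le2 : (\sum_(i < n) nth 0%N x (n.+1 + i) <= s)%N.
  by rewrite -x2 /bideg2 big_ord_recr leq_addr.
have in1 (i : 'I_n) : val (inord (nth 0%N x i) : 'I_r.+1) = nth 0%N x i.
  by rewrite /= inordK // ltnS (leq_trans _ le1) // (bigD1 i) //= leq_addr.
have in2 (i : 'I_n) : val (inord (nth 0%N x (n.+1 + i)) : 'I_s.+1) = nth 0%N x (n.+1 + i).
  by rewrite /= inordK // ltnS (leq_trans _ le2) // (bigD1 i) //= leq_addr.
(* Forgetting the slacks gives the index of the monomial; each exponent is bounded by its half sum,
   so [inord] is exact. *)
pose t0 : 'I_m * {ffun 'I_n -> 'I_r.+1} * {ffun 'I_n -> 'I_s.+1} :=
  (Ordinal km, [ffun i : 'I_n => inord (nth 0%N x i)],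
   [ffun i : 'I_n => inord (nth 0%N x (n.+1 + i))]).
exists [ffun t => (if t == t0 then a else 0) + c t].
under [RHS]eq_bigr do rewrite ffunE scalerDl.
rewrite big_split /=; congr (_ + _); rewrite (bigD1 t0) /=; last first.
  under eq_bigr do rewrite ffunE in1; rewrite le1 /=.
  by under eq_bigr do rewrite ffunE in2.
rewrite eqxx big1 ?addr0 => [|t /andP[_ /negbTE->]]; last by rewrite scale0r.
congr (_ *: _); rewrite /mono /weyl_mono /= insubT /=.
transitivity (act X (fun j : 'I_n => nth 0%N x j) (enum 'I_n)
  (act D (fun j : 'I_n => val (inord (nth 0%N x (n.+1 + j)) : 'I_s.+1)) (enum 'I_n) (f (Ordinal km)))).
  by congr (act _ _ _ _); apply: eq_act => j _; rewrite in2.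
transitivity (act X (fun j : 'I_n => nth 0%N x j) (enum 'I_n)
  (act D (fun j : 'I_n => val (t0.2 j)) (enum 'I_n) (f (Ordinal km)))).
  by congr (act _ _ _ _); apply: eq_act => j _; rewrite ffunE.
by apply: eq_act => j _; rewrite ffunE in1.
Qed.

Lemma hilb2_dim (K : fieldType) (M : lmodType K) (n m : nat) (X D : 'I_n -> M -> M)
    (f : 'I_m -> M) : weyl_action X D ->
  exists2 h : nat -> nat -> int, hilb2 n.+1 n.+1 h &
    forall r s, exists2 d : nat, has_dim (in_Mrs X D f r s) d & h r s = d%:Z.
Proof.
move=> hM; pose w := mono X D (fun k => oapp f 0 (insub k)).
(* The bidegree is read off [v] itself, so one set serves all (r,s). *)
pose S k v := ~~ `[< lspan (below m X D (fun k => oapp f 0 (insub k))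
  (bideg1 n v) (bideg2 n v) (k :: v)) (w (k :: v)) >].
exists (fun r s => \sum_(k <- iota 0 m) if (k < m)%N then cnt n.+1 n.+1 (S k) r s else 0).
  apply: hilb2_sum => k; case: ltnP => km; last exact: hilb2_0.
  apply: hilb2_cnt => v i sv iN; apply: contra => /asboolP vP; apply/asboolP.
  exact: lspan_below_incr.
move=> r s; exists (\sum_(x <- midx m n r s) irreducible (midx m n r s) w x)%N.
  rewrite -rk_irreducible ?midx_uniq //.
  apply: eq_has_dim (has_dim_lspan _) => u; rewrite in_MrsE; apply: eq_lspan => v.
  split=> [/mapP[x]|[x xL ->]]; last by apply: map_f; rewrite mem_rev mem_sort.
  by rewrite mem_rev mem_sort; exists x.
(* Every index listed for M_rs has bidegree (r,s), so there irreducibility in M_rs is membership in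
   [S]. *)
rewrite (eq_big_seq (fun x : seq nat => (S (head 0%N x) (behead x) : nat))); last first.
  by move=> _ /mem_midx[k [v [-> _ _ <- <-]]].
rewrite (big_morph Posz PoszD (erefl 0%:Z)) big_allpairs_dep.
apply: eq_big_seq => k; rewrite mem_iota => /= ->.
by rewrite big_allpairs_dep.
Qed.

Theorem theorem5p4 (K : fieldType) (hK : [pchar K] =i pred0)
  (n : nat) (M : lmodType K) (X D : 'I_n -> M -> M)
  (hM : weyl_action X D) (m : nat) (f : 'I_m -> M) (hf : generates X D f) :
  exists a : 'I_n.+1 -> 'I_n.+1 -> int,
  exists r0 s0 : nat, forall r s : nat, (r0 <= r)%N -> (s0 <= s)%N ->
    exists d : nat, has_dim (in_Mrs X D f r s) d /\
      (d%:Z = \sum_(i < n.+1) \sum_(j < n.+1)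
                a i j * ('C(r + i, i) * 'C(s + j, j))%:Z).
Proof.
have [h /hilb2_poly[a [r0 [s0 aP]]] hP] := hilb2_dim f hM.
exists a, r0, s0 => r s rr ss; have [d dimP hd] := hP r s.
by exists d; rewrite -hd aP.
Qed.
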